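(* Every Hausdorff shift-continuous Čech-complete topology $\tau$ on the semigroup $\mathbf{ID}_{\infty}$ is discrete; hence also every Hausdorff shift-continuous locally compact topology on $\mathbf{ID}_{\infty}$ is discrete.
   Context: A partial cofinite isometry of the set of integers $\mathbb{Z}$ is a partial map $\alpha\colon\mathbb{Z}\rightharpoonup\mathbb{Z}$ such that $\mathbb{Z}\setminus\operatorname{dom}\alpha$ and $\mathbb{Z}\setminus\operatorname{ran}\alpha$ are finite and $|(x)\alpha-(y)\alpha|=|x-y|$ for all $x,y\in\operatorname{dom}\alpha$. $\mathbf{ID}_{\infty}$ is the semigroup (an inverse monoid) of all partial cofinite isometries of $\mathbb{Z}$ under composition of partial maps (maps written on the right). A topology $\tau$ on a semigroup $S$ is shift-continuous if the semigroup operation is separately continuous, i.e. all left translations $x\mapsto sx$ and all right translations $x\mapsto xs$ ($s\in S$) are continuous on $(S,\tau)$. A space $X$ is Čech-complete if it is completely regular (Tychonoff) and the remainder $\beta X\setminus X$ of its Stone–Čech compactification $\beta X$ is an $F_\sigma$-set in $\beta X$. A space is locally compact if each point has an open neighbourhood with compact closure. *)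

(* Defs.v *)
From HB Require Import structures.
From mathcomp Require Import all_boot all_order all_algebra.
From mathcomp Require Import all_classical all_reals all_analysis.
From mathcomp Require Import borel_hierarchy.

Set Implicit Arguments.
Unset Strict Implicit.
Unset Printing Implicit Defensive.

Import Order.TTheory GRing.Theory Num.Theory.
Import numFieldNormedType.Exports.

Local Open Scope classical_set_scope.
Local Open Scope ring_scope.

(* A partial map from X to Y is a function X -> option Y, undefined where its
   value is None. *)
Section partial_maps.
Context {X Y Z : Type}.

Definition pdom (f : X -> option Y) : set X :=
  [set x | exists y, f x = Some y].

Definition pran (f : X -> option Y) : set Y :=
  [set y | exists x, f x = Some y].

(* Maps act on the right: x (f g) = (x f) g. *)
Definition pcomp (f : X -> option Y) (g : Y -> option Z) : X -> option Z :=
  fun x => obind g (f x).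

End partial_maps.

Definition cofinite_isometry (f : int -> option int) : Prop :=
  [/\ finite_set (~` pdom f),
      finite_set (~` pran f) &
      forall x y a b : int, f x = Some a -> f y = Some b ->
        `|a - b| = `|x - y|].

Record IDinf := MkIDinf {
  pmap_of :> int -> option int;
  pmap_ofP : cofinite_isometry pmap_of
}.

Lemma IDinf_ext (f g : IDinf) : (f : int -> option int) =1 g -> f = g.
Proof.
case: f g => [f fP] [g gP] /= /funext fg.
by case: _ / fg in gP *; congr MkIDinf; exact: Prop_irrelevance.
Qed.

Lemma cofinite_isometry_inj (f : int -> option int) (x y a : int) :
  cofinite_isometry f -> f x = Some a -> f y = Some a -> x = y.
Proof.
move=> [_ _ fiso] fx fy; apply/eqP; rewrite -subr_eq0 -normr_eq0.
by rewrite -(fiso _ _ _ _ fx fy) subrr normr0.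
Qed.

Lemma cofinite_isometry_comp (f g : int -> option int) :
  cofinite_isometry f -> cofinite_isometry g -> cofinite_isometry (pcomp f g).
Proof.
move=> fP gP; have [fd fr fi] := fP; have [gd gr gi] := gP; split.
- pose h b := if pselect (exists x, f x = Some b) is left e
              then projT1 (cid e) else 0.
  apply: (@sub_finite_set _ _ (~` pdom f `|` h @` (~` pdom g))).
    move=> x /= nfg; case E: (f x) => [b|]; last first.
      by left => -[y]; rewrite E.
    right; exists b.
      by move=> [c gb]; apply: nfg; exists c; rewrite /pcomp E.
    rewrite /h; case: pselect => [e|[]]; last by exists x.
    by apply: cofinite_isometry_inj fP (projT2 (cid e)) E.
  by rewrite finite_setU; split=> //; exact: finite_image.
- apply: (@sub_finite_set _ _ (~` pran g `|` (odflt 0 \o g) @` (~` pran f))).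
    move=> c /= nfg; have [[b gb]|ng] := pselect (pran g c); last by left.
    right; exists b; last by rewrite /= gb.
    by move=> [x fx]; apply: nfg; exists x; rewrite /pcomp fx.
  by rewrite finite_setU; split=> //; exact: finite_image.
- move=> x y a b; rewrite /pcomp.
  case Ex: (f x) => [u|] //=; case Ey: (f y) => [v|] //= gu gv.
  by rewrite (gi _ _ _ _ gu gv) (fi _ _ _ _ Ex Ey).
Qed.

Lemma cofinite_isometry_id : cofinite_isometry Some.
Proof.
split=> [||x y a b [->] [->]//].
- by rewrite (_ : pdom _ = setT) ?setCT//; apply/seteqP; split=> // x _; exists x.
- by rewrite (_ : pran _ = setT) ?setCT//; apply/seteqP; split=> // x _; exists x.
Qed.

Definition IDinf_mul (f g : IDinf) : IDinf :=
  MkIDinf (cofinite_isometry_comp (pmap_ofP f) (pmap_ofP g)).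

Definition IDinf_one : IDinf := MkIDinf cofinite_isometry_id.

Lemma IDinf_mulA : associative IDinf_mul.
Proof. by move=> f g h; apply: IDinf_ext => x /=; rewrite /pcomp; case: (f x). Qed.

Lemma IDinf_mul1 : left_id IDinf_one IDinf_mul.
Proof. by move=> f; exact: IDinf_ext. Qed.

Lemma IDinf_mulr1 : right_id IDinf_one IDinf_mul.
Proof. by move=> f; apply: IDinf_ext => x /=; rewrite /pcomp; case: (f x). Qed.

HB.instance Definition _ := gen_eqMixin IDinf.
HB.instance Definition _ := gen_choiceMixin IDinf.
HB.instance Definition _ :=
  isMonoid.Build IDinf IDinf_mulA IDinf_mul1 IDinf_mulr1.

(* A topology on X as a family of open sets, so that one can quantify over all
   topologies on a fixed carrier; [tspace tau] is the space (X, tau). *)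
Record topology_on (X : choiceType) := TopologyOn {
  opens : set_system X;
  opens_setT : opens setT;
  opens_setI : setI_closed opens;
  opens_bigcup : forall (I : Type) (F : I -> set X),
    (forall i, opens (F i)) -> opens (\bigcup_i F i)
}.

Definition tspace (X : choiceType) (tau : topology_on X) : Type := X.

HB.instance Definition _ (X : choiceType) (tau : topology_on X) :=
  Choice.on (tspace tau).
HB.instance Definition _ (X : choiceType) (tau : topology_on X) :=
  isOpenTopological.Build (tspace tau)
    (opens_setT tau) (@opens_setI _ tau) (@opens_bigcup _ tau).

Definition shift_continuous (S : semigroupType) (tau : topology_on S) : Prop :=
  forall s : S,
    continuous ((fun x => (s * x)%g) : tspace tau -> tspace tau) /\
    continuous ((fun x => (x * s)%g) : tspace tau -> tspace tau).

Definition discrete_space (X : topologicalType) : Prop :=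
  forall A : set X, open A.

Definition tychonoff_space (X : topologicalType) : Prop :=
  accessible_space X /\ completely_regular_space X.

(* The Stone-Cech compactification of X is the closure of the image of X in the
   cube [0, 1]^C(X, [0, 1]) under the evaluation map x |-> (f x)_f. *)
Section stone_cech.
Variables (R : realType) (X : topologicalType).

Definition unit_interval : topologicalType := set_type `[0 : R, 1]%classic.

Definition stone_cech_cube : topologicalType :=
  prod_topology (fun _ : continuousType X unit_interval => unit_interval).

Definition stone_cech_eval : X -> stone_cech_cube := fun x f => f x.

Definition stone_cech : topologicalType :=
  set_type (closure (range stone_cech_eval)).

Definition stone_cech_remainder : set stone_cech :=
  [set p | ~ range stone_cech_eval (set_val p)].

Definition cech_complete : Prop :=
  tychonoff_space X /\ Fsigma stone_cech_remainder.

End stone_cech.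

Lemma locally_compactP (X : topologicalType) :
  locally_compact [set: X] <->
  forall x : X, exists2 U : set X, open_nbhs x U & compact (closure U).
Proof.
split=> lc x => [|_].
  have [K xK [cK clK]] := lc x I.
  move: xK; rewrite withinE => -[V xV]; rewrite !setIT => KV; subst V.
  exists K°; first by split; [exact: open_interior|].
  apply: (subclosed_compact _ cK); first exact: closed_closure.
  by have := closureS (@interior_subset _ K); rewrite -(closure_id K).1.
have [U oU cU] := lc x; exists (closure U).
  apply: filterS (open_nbhs_nbhs oU) => y Uy _; exact: subset_closure.
by split=> //; exact: closed_closure.
Qed.

(* Main.v *)
Require Import Defs.
From mathcomp Require Import all_boot all_order all_algebra.
From mathcomp Require Import all_classical all_reals all_analysis.
From mathcomp Require Import finmap zify.

(** The proof combines a Baire-type theorem with a finiteness property of the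
semigroup.

Both completeness hypotheses yield a sequence of covers [W n] by neighbourhoods
such that a decreasing sequence of nonempty closed sets, the [n]-th of which
lies in a member of [W n], has a common point ([complete_covers]; this is
Frolik's internal description of Cech-completeness).  For a locally compact
space take the sets with compact closure.  For a Cech-complete space whose
remainder is the union of closed sets [F n], take the sets whose closure in the
Stone-Cech compactification misses [F n]: a common point of the closures of the
given sets avoids every [F n], hence comes from the space itself.  In a
regular T1 space, nested neighbourhoods that avoid the points of a countable set
one after the other then show that a nonempty countable closed set has a
relatively isolated point ([countable_closed_isolated]).

A partial cofinite isometry is determined by its domain and its values at two
points.  Hence the semigroup is countable, and each of its elements has
finitely many extensions, so each equation [s * x = g] or [x * s = g] has
finitely many solutions.  In a T1 shift-continuous topology the solution set of
such an equation is open when [g] is isolated, and a finite open set consists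
of isolated points; so [x] is isolated as soon as [s * x] or [x * s] is.  That
is, the non-isolated points form a closed two-sided ideal [J].  If [J] were
nonempty, some neighbourhood [V] would meet it in a single point [a].  Choose
[b] with [a * b * a = a] and put [e = a * b], which lies in the ideal [J] with
[a].  The map [x |-> e * x] is continuous, has all its values in
[J] and fixes [a], so near [a] its only value is [a].  The finitely many
solutions of [e * x = a] therefore contain a neighbourhood of [a], which makes
[a] isolated, a contradiction ([regular_semigroup_discrete]). *)

Import Order.TTheory GRing.Theory Num.Theory.
Import numFieldNormedType.Exports.

Set Implicit Arguments.
Unset Strict Implicit.
Unset Printing Implicit Defensive.

Local Open Scope classical_set_scope.

(** * Compactness *)

Lemma compact_decreasing (T : topologicalType) (A : set T)
    (K : nat -> set T) :
  compact A -> K 0%N `<=` A -> (forall n, closed (K n)) ->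
  (forall n, K n !=set0) -> (forall n, K n.+1 `<=` K n) ->
  \bigcap_n K n !=set0.
Proof.
move=> cA K0A clK K0 Kdecr.
have KS m n : (m <= n)%N -> K n `<=` K m.
  move=> /subnK <-; elim: (n - m)%N => [//|k IH].
  by apply: subset_trans IH; rewrite addSn; exact: Kdecr.
have PF : ProperFilter (filter_from setT K).
  apply: filter_from_proper => //.
  apply: filter_from_filter; first by exists 0%N.
  move=> m n _ _; exists (maxn m n) => // x Kx.
  by split; apply: KS Kx; rewrite ?leq_maxl ?leq_maxr.
have FA : filter_from setT K A by exists 0%N.
have [p [_ cp]] := cA _ PF FA; exists p => n _.
by apply: clK => V /(cp (K n)); apply; exists n.
Qed.

Lemma set_type_hausdorff (T : topologicalType) (A : set T) :
  hausdorff_space T -> hausdorff_space (set_type A).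
Proof.
move=> hT p q pq; apply: val_inj; apply: hT => U V pU qV.
have cv := @initial_continuous (set_type A) T set_val.
by have [x [Ux Vx]] := pq _ _ (cv p U pU) (cv q V qV); exists (set_val x).
Qed.

Lemma set_type_compact (T : topologicalType) (A : set T) :
  compact A -> compact [set: set_type A].
Proof.
move=> cA F PF _.
have FA : (set_val @ F) A.
  by apply: (@filterS _ F _ setT) => [x _|]; [exact: set_valP|exact: filterT].
have [p [Ap cp]] := cA _ (fmap_proper_filter _ PF) FA.
exists (SigSub (mem_set Ap)); split=> // B V FB [_ [[W oW <-] /= Wp] WV].
have [||_ [[b Bb <-] Wb]] := cp (set_val @` B) W.
- by apply: (@filterS _ F _ B) FB => b Bb; exists b.
- exact: open_nbhs_nbhs.
- by exists b; split=> //; exact: WV.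
Qed.

(** * Baire category through complete sequences of covers *)

(** For Tychonoff spaces, Cech-completeness in a form that does not mention a
compactification. *)
Definition complete_covers (X : topologicalType)
    (W : nat -> set (set X)) : Prop :=
  (forall n (x : X), exists2 U : set X, W n U & nbhs x U) /\
  (forall K : nat -> set X, (forall n, closed (K n)) ->
     (forall n, K n !=set0) -> (forall n, K n.+1 `<=` K n) ->
     (forall n, exists2 U, W n U & K n `<=` U) -> \bigcap_n K n !=set0).

(** Suppose that no point of [C] is isolated in [C].  Then every open set that
meets [C] still does so after the loss of one point, so shrinking open sets can
avoid the points of [C], numbered by an injection [f], one by one.
Completeness gives a point of [C] common to the closures of these sets, which
is absurd. *)
Lemma countable_closed_isolated (X : topologicalType)
    (W : nat -> set (set X)) (C : set X) :
  accessible_space X -> regular_space X -> complete_covers W ->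
  closed C -> C !=set0 -> countable C -> isolated C !=set0.
Proof.
move=> T1 reg [Wcov Wcap] clC [x0 Cx0] /countable_injP[f f_inj].
have finj x y : C x -> C y -> f x = f y -> x = y.
  by move=> Cx Cy; apply: f_inj; exact/mem_set.
apply: contrapT => noiso.
have fork n (U : set X) : open U -> U `&` C !=set0 ->
    exists2 y, U y & C y /\ f y <> n.
  move=> oU [x [Ux Cx]]; have [fx|] := pselect (f x = n); last by exists x.
  apply: contrapT => ny; apply: noiso; exists x; split; first exact/mem_set.
  exists U; first exact: open_nbhs_nbhs.
  rewrite eqEsubset; split=> [y [Uy Cy]|_ ->//].
  apply: finj; rewrite // fx; apply: contrapT => fy.
  by apply: ny; exists y.
(* [V] is an admissible successor of [U] at stage [n]: it shrinks into a member
   of the cover [W n] and avoids the point of [C] with number [n]. *)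
pose good n (U V : set X) := open U -> U `&` C !=set0 ->
  [/\ open V, V `&` C !=set0, closure V `<=` U,
      (exists2 Q, W n Q & closure V `<=` Q) &
      forall x, closure V x -> C x -> f x <> n].
have step n U : exists V, good n U V.
  have [[oU UC]|nU] := pselect (open U /\ U `&` C !=set0); last first.
    by exists set0 => oU UC; case: nU.
  have [y Uy [Cy fy]] := fork n U oU UC.
  have [Q WO yO] := Wcov n y.
  have fin : finite_set [set x | C x /\ f x = n].
    have [[z [Cz fz]]|nz] := pselect (exists z, C z /\ f z = n).
      apply: (@sub_finite_set _ _ [set z]); last exact: finite_set1.
      by move=> x [Cx fx]; apply: finj; rewrite // fx.
    by apply: (@sub_finite_set _ _ set0) => [x Cx|//]; case: nz; exists x.
  have yN : nbhs y (U `&` Q `&` ~` [set x | C x /\ f x = n]).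
    apply: filterI; first by apply: filterI => //; exact: open_nbhs_nbhs.
    apply: open_nbhs_nbhs; split; last by move=> [].
    exact: closed_openC (accessible_finite_set_closed.1 T1 _ fin).
  have [V yV VN] := reg _ _ yN.
  exists (interior V) => _ _; have iV := closureS (@interior_subset _ V).
  split.
  - exact: open_interior.
  - by exists y.
  - by move=> z /iV /VN [[]].
  - by exists Q => // z /iV /VN [[]].
  - by move=> z /iV /VN [_ zn] Cz fz; exact: zn.
have [g gP] := choice (fun p : nat * set X => step p.1 p.2).
pose U := fix U n := if n is m.+1 then g (m, U m) else setT.
have UP n : open (U n) /\ U n `&` C !=set0.
  elim: n => [|n [oU UC]]; first by split; [exact: openT|exists x0].
  by have [] := gP (n, U n) oU UC.
(* The index is shifted because [U 0] is the whole space, which need not lie in a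
   member of [W 0]. *)
pose K n := closure (U n.+1) `&` C.
have gU n := gP (n, U n) (UP n).1 (UP n).2.
have [x Kx] : \bigcap_n K n !=set0.
  apply: Wcap => n.
  - by apply: closedI => //; exact: closed_closure.
  - have [z [Uz Cz]] := (UP n.+1).2; exists z.
    by split=> //; exact: subset_closure.
  - move=> z [Uz Cz]; split=> //; apply: subset_closure.
    by have [_ _ sub _ _] := gU n.+1; exact: sub.
  - have [_ _ _ [Q WO UO] _] := gU n.
    by exists Q => // z [/UO].
have [Ux Cx] := Kx (f x) I.
by have [_ _ _ _ /(_ x Ux Cx)] := gU (f x).
Qed.

Lemma locally_compact_complete_covers (X : topologicalType) :
  locally_compact [set: X] ->
  complete_covers (fun=> [set U : set X | compact (closure U)]).
Proof.
move=> /locally_compactP lc; split=> [_ x|K clK K0 Kdecr KU].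
  by have [U /open_nbhs_nbhs xU cU] := lc x; exists U.
have [U cU KU0] := KU 0%N.
apply: compact_decreasing cU _ clK K0 Kdecr.
exact: subset_trans KU0 (@subset_closure _ _).
Qed.

Lemma locally_compact_regular (X : topologicalType) :
  hausdorff_space X -> locally_compact [set: X] -> regular_space X.
Proof.
move=> hX /locally_compactP lc x; have [U xU cU] := lc x.
apply: compact_regular cU _ => //.
by apply: filterS (open_nbhs_nbhs xU); exact: subset_closure.
Qed.

(** * Complete covers of a Cech-complete space *)

Section cech_complete_covers.
Variables (R : realType) (X : topologicalType).
Hypothesis crX : completely_regular_space X.

Local Notation cube := (stone_cech_cube R X).
Local Notation beta := (stone_cech R X).
Local Notation eval := (stone_cech_eval (R := R) (X := X)).

Definition stone_cech_map (x : X) : beta :=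
  SigSub (mem_set (@subset_closure cube (range eval) (eval x) (imageT _ x))).

Lemma cube_proj_continuous (f : continuousType X (unit_interval R)) :
  continuous (fun p : cube => p f).
Proof. exact: (@proj_continuous _ (fun _ => unit_interval R) f). Qed.

Lemma unit_interval_hausdorff : hausdorff_space (unit_interval R).
Proof. exact/set_type_hausdorff/Rhausdorff. Qed.

Lemma unit_interval_compact : compact [set: unit_interval R].
Proof. exact/set_type_compact/segment_compact. Qed.

Lemma stone_cech_hausdorff : hausdorff_space beta.
Proof.
apply/set_type_hausdorff/hausdorff_product => _; exact: unit_interval_hausdorff.
Qed.

Lemma stone_cech_compact : compact [set: beta].
Proof.
apply: set_type_compact.
apply: (@subclosed_compact cube _ setT) => //; first exact: closed_closure.
have := @tychonoff _
  (fun _ : continuousType X (unit_interval R) => unit_interval R)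
  (fun=> setT) (fun=> unit_interval_compact).
by congr compact; apply/seteqP; split.
Qed.

Lemma stone_cech_map_continuous : continuous stone_cech_map.
Proof.
apply: continuous_comp_initial.
move=> x. apply/cvg_sup => f U [_ [[W oW <-] /= Wfx] WU].
apply: filterS WU _ => /=; apply: (@cts_fun _ _ f x).
exact: open_nbhs_nbhs.
Qed.

(** Complete regularity makes the canonical map an embedding: a real function
that separates [x] from [K] is a coordinate of the cube, and it stays equal to
1 on the closure of the image of [K]. *)
Lemma stone_cech_map_closure (K : set X) (x : X) :
  closed K -> closure (stone_cech_map @` K) (stone_cech_map x) -> K x.
Proof.
move=> clK cx; apply: contrapT => Kx.
have /(@uniform_separatorP _ R)[f [cf f01 f0 f1]] := crX clK Kx.
pose g y : unit_interval R := SigSub (mem_set (f01 _ (imageT f y))).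
have cg : continuous g by exact: continuous_comp_initial.
pose gc : continuousType X (unit_interval R) := mkcts cg.
pose h (p : beta) : R := set_val (set_val p gc).
have ch : continuous h.
  move=> p; apply: (@continuous_comp _ _ _ (fun p : beta => set_val p gc)
    (set_val : unit_interval R -> R)); last exact: initial_continuous.
  apply: (@continuous_comp _ _ _ (set_val : beta -> cube)
    (fun q : cube => q gc)); last exact: cube_proj_continuous.
  exact: initial_continuous.
have cl1 : closed (h @^-1` [set 1%R]).
  apply: preimage_closed; first by move=> ? _; exact: ch.
  exact: accessible_closed_set1 (hausdorff_accessible (@Rhausdorff R)) _.
have : (h @^-1` [set 1%R]) (stone_cech_map x).
  apply: cl1; apply: closureS cx => _ [y Ky <-] /=.
  by apply: f1; exists y.
have /= -> : h (stone_cech_map x) = 0%R by apply: f0; exists x.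
by move/eqP; rewrite eq_sym oner_eq0.
Qed.

(** The closures of the images of the [K n] have a common point [p] by
compactness.  The [n]-th cover keeps [p] out of [F n], so [p] is not in the
remainder. *)
Lemma cech_complete_covers (F : nat -> set beta) :
  (forall n, closed (F n)) ->
  stone_cech_remainder (R := R) (X := X) = \bigcup_n F n ->
  complete_covers
    (fun n => [set U : set X | closure (stone_cech_map @` U) `&` F n = set0]).
Proof.
move=> clF remF; split=> [n x|K clK K0 Kdecr KU].
  have nF : nbhs (stone_cech_map x) (~` F n).
    apply: open_nbhs_nbhs; split; first exact: closed_openC.
    move=> Fx; have : (\bigcup_n F n) (stone_cech_map x) by exists n.
    by rewrite -remF; apply; exists x.
  have [V xV VF] :=
    compact_regular stone_cech_hausdorff stone_cech_compact filterT nF.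
  exists (stone_cech_map @^-1` V); last exact: stone_cech_map_continuous.
  apply/disjoints_subset; apply: subset_trans VF; apply: closureS.
  exact: image_preimage_subset.
have [p Kp] : \bigcap_n closure (stone_cech_map @` K n) !=set0.
  apply: (compact_decreasing stone_cech_compact) => // n.
  - exact: closed_closure.
  - have [x Kx] := K0 n; exists (stone_cech_map x).
    by apply: subset_closure; exists x.
  - by apply: closureS; exact: image_subset.
have : ~ (\bigcup_n F n) p.
  move=> [n _ Fp]; have [U UF KU'] := KU n.
  have : (closure (stone_cech_map @` U) `&` F n) p.
    by split=> //; apply: (closureS _ (Kp n I)); exact: image_subset.
  by rewrite UF.
rewrite -remF => /contrapT [x _ xp].
have {}xp : stone_cech_map x = p by exact: val_inj.
by exists x => n _; apply: stone_cech_map_closure => //; rewrite xp; exact: Kp.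
Qed.

End cech_complete_covers.

(** * Semigroups with finite translation fibres *)

Lemma open_finite_point (X : topologicalType) (U : set X) (x : X) :
  accessible_space X -> open U -> finite_set U -> U x -> open [set x].
Proof.
move=> T1 oU fU Ux.
have -> : [set x] = U `&` ~` (U `\ x).
  rewrite eqEsubset; split=> [_ ->|y [Uy /not_andP[//|/contrapT ->//]]].
  by split=> // -[_]; apply.
apply: openI => //; apply: closed_openC.
exact: accessible_finite_set_closed.1 T1 _ (finite_setD _ fU).
Qed.

Definition finite_translation_fibers (S : semigroupType) : Prop :=
  forall s g : S, finite_set [set x : S | (s * x)%g = g] /\
                  finite_set [set x : S | (x * s)%g = g].

(** The non-isolated points form a closed two-sided ideal, which would have a
relatively isolated point [a] if it were nonempty.  Left translation by the
idempotent [a * b] retracts a neighbourhood of [a] to [a], and its fibre over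
[a] is finite; so [a] would be isolated in the whole space. *)
Lemma regular_semigroup_discrete (S : semigroupType) (tau : topology_on S)
    (W : nat -> set (set (tspace tau))) :
  finite_translation_fibers S ->
  (forall a : S, exists b : S, (a * b * a)%g = a) ->
  countable [set: S] ->
  shift_continuous tau ->
  accessible_space (tspace tau) -> regular_space (tspace tau) ->
  complete_covers W -> discrete_space (tspace tau).
Proof.
move=> fib vnr cS sc T1 reg cW.
pose I : set (tspace tau) := [set x | open [set x]].
suff allI : forall x, I x.
  move=> A; have -> : A = \bigcup_(x in A) [set x].
    by rewrite bigcup_imset1 image_id.
  by apply: bigcup_open => x _; exact: allI.
have IL (s x : tspace tau) : I (s * x)%g -> I x.
  move=> Isx.
  have := @open_finite_point (tspace tau)
    [set y : S | (s * y)%g = (s * x)%g] x T1.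
  apply => //; last by have [] := fib s (s * x)%g.
  by have [/continuousP/(_ _ Isx)] := sc s.
have IR (s x : tspace tau) : I (x * s)%g -> I x.
  move=> Isx.
  have := @open_finite_point (tspace tau)
    [set y : S | (y * s)%g = (x * s)%g] x T1.
  apply => //; last by have [] := fib s (x * s)%g.
  by have [_ /continuousP/(_ _ Isx)] := sc s.
move=> x; apply: contrapT => nIx.
have clnI : closed (~` I).
  apply: open_closedC; have -> : I = \bigcup_(y in I) [set y].
    by rewrite bigcup_imset1 image_id.
  by apply: bigcup_open.
have cnI : countable (~` I) by apply: sub_countable cS; exact: subset_card_le.
have [a [/set_mem nIa [V aV VI]]] :=
  countable_closed_isolated T1 reg cW clnI (ex_intro _ x nIx) cnI.
have [b aba] := vnr a.
have nIab : ~ I (a * b)%g by move=> /IR.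
have {aV}aV :
    nbhs a ((fun y : tspace tau => (a * b * y)%g : tspace tau) @^-1` V).
  by have [c _] := sc (a * b)%g; apply: c; rewrite /= aba.
apply: nIa; move: aV; rewrite nbhsE => -[U [oU Ua] UV].
apply: open_finite_point oU _ Ua => //.
have [+ _] := fib (a * b)%g a; apply: sub_finite_set => y /UV /= Vy.
have : (V `&` ~` I) (a * b * y)%g by split=> // /IR.
by rewrite VI.
Qed.

(** * Partial cofinite isometries of the integers *)

Lemma cofinite_int_nonempty (F : set int) : finite_set F -> exists x, ~ F x.
Proof.
move=> fF; apply: contrapT => nF; apply: infinite_nat.
apply: (@sub_finite_set _ _ (Posz @^-1` F)).
  by move=> n _ /=; apply: contrapT => Fn; apply: nF; exists (Posz n).
by apply: finite_preimage fF => m n _ _ [].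
Qed.

Lemma IDinf_two_points (f : IDinf) :
  exists a b a' b', [/\ a <> b, f a = Some a' & f b = Some b'].
Proof.
have [fd _ _] := pmap_ofP f.
have [a /contrapT [a' fa]] := cofinite_int_nonempty fd.
have [|b] := @cofinite_int_nonempty (~` pdom f `|` [set a]).
  by rewrite finite_setU; split.
move=> /not_orP [/contrapT [b' fb] ab].
by exists a, b, a', b'; split=> // ba; apply: ab; rewrite ba.
Qed.

(** An integer is determined by its distances to two distinct integers. *)
Lemma IDinf_determined (f g : IDinf) (a b a' b' : int) : a <> b ->
  f a = Some a' -> f b = Some b' -> g a = Some a' -> g b = Some b' ->
  pdom f = pdom g -> f = g.
Proof.
move=> ab fa fb ga gb dom; apply: IDinf_ext => x.
have [_ _ fi] := pmap_ofP f; have [_ _ gi] := pmap_ofP g.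
have fg : pdom f x <-> pdom g x by rewrite dom.
case fx: (f x) => [y|]; case gx: (g x) => [z|] //.
- have := fi _ _ _ _ fa fb; have := fi _ _ _ _ fx fa; have := fi _ _ _ _ fx fb.
  have := gi _ _ _ _ gx ga; have := gi _ _ _ _ gx gb.
  move=> ? ? ? ? ?; congr Some; lia.
- by case: fg => /(_ (ex_intro _ y fx)) [z]; rewrite gx.
- by case: fg => _ /(_ (ex_intro _ z gx)) [y]; rewrite fx.
Qed.

(** Once two points and their images are fixed, an element is determined by the
finite complement of its domain. *)
Lemma countable_IDinf : countable [set: IDinf].
Proof.
pose P (p : int * int * int * int) : set IDinf :=
  let: (a, b, a', b') := p in
  [set f | [/\ a <> b, f a = Some a' & f b = Some b']].
apply: (@sub_countable _ _ _ (\bigcup_p P p)).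
  apply: subset_card_le => f _; have [a [b [a' [b' fP]]]] := IDinf_two_points f.
  by exists (a, b, a', b').
apply: bigcup_countable; first exact: countableP.
move=> [[[a b] a'] b'] _.
have /countable_injP[h hinj] :=
  @countable_finite_subset int setT (countableP _).
apply/countable_injP; exists (fun f : IDinf => h (~` pdom f)).
move=> f g /set_mem [ab fa fb] /set_mem [_ ga gb] hfg.
apply: (IDinf_determined ab fa fb ga gb); apply: setC_inj; apply: hinj => //.
- by apply/mem_set; split=> //; have [] := pmap_ofP f.
- by apply/mem_set; split=> //; have [] := pmap_ofP g.
Qed.

Lemma finite_subsets (T : choiceType) (A : set T) :
  finite_set A -> finite_set [set B : set T | B `<=` A].
Proof.
move=> fA.
apply: (@sub_finite_set _ _ ((fun B : {fset T} => [set` B]) @`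
  [set` fpowerset (fset_set A)])).
  move=> B BA; have fB := sub_finite_set BA fA.
  by exists (fset_set B); rewrite /= ?fset_setK// fpowersetE -fset_set_sub.
exact/finite_image/finite_fset.
Qed.

(** All extensions of [f] agree with it at two points, so they are told apart by
the complements of their domains, which are subsets of one finite set. *)
Lemma IDinf_finite_extensions (f : IDinf) :
  finite_set [set g : IDinf | forall x y, f x = Some y -> g x = Some y].
Proof.
have [a [b [a' [b' [ab fa fb]]]]] := IDinf_two_points f.
have [fd _ _] := pmap_ofP f.
have := finite_subsets fd; apply: card_le_finite.
set A := [set g | _].
have dom_inj : {in A &, injective (fun g : IDinf => ~` pdom g)}.
  move=> g h /set_mem Ag /set_mem Ah /setC_inj.
  exact: IDinf_determined ab (Ag _ _ fa) (Ag _ _ fb) (Ah _ _ fa) (Ah _ _ fb).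
apply: (@card_le_trans _ _ _ ((fun g : IDinf => ~` pdom g) @` A)); last first.
  apply: subset_card_le => _ [g Ag <-] /=; apply: subsetC => x [y /Ag gx].
  by exists y.
by rewrite -(card_le_eql (inj_card_eq dom_inj)).
Qed.

Definition partial_inverse (f : int -> option int) (y : int) : option int :=
  if pselect (exists x, f x = Some y) is left e then Some (projT1 (cid e))
  else None.

Lemma partial_inverseP (f : IDinf) (x y : int) :
  partial_inverse f y = Some x <-> f x = Some y.
Proof.
rewrite /partial_inverse; case: pselect => [e|ne]; last first.
  by split=> // fx; case: ne; exists x.
split=> [[<-]|fx]; first exact: projT2 (cid e).
by congr Some; exact: cofinite_isometry_inj (pmap_ofP f) (projT2 (cid e)) fx.
Qed.

Lemma cofinite_isometry_inverse (f : IDinf) :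
  cofinite_isometry (partial_inverse f).
Proof.
have [fd fr fi] := pmap_ofP f; split.
- apply: sub_finite_set fr; apply: subsetC => y [x fx].
  by exists x; apply/partial_inverseP.
- apply: sub_finite_set fd; apply: subsetC => x [y fx].
  by exists y; apply/partial_inverseP.
- move=> x y a b /partial_inverseP fa /partial_inverseP fb.
  by rewrite (fi _ _ _ _ fa fb).
Qed.

Definition IDinf_inv (f : IDinf) : IDinf :=
  MkIDinf (cofinite_isometry_inverse f).

Lemma IDinf_mulE (f g : IDinf) (x z : int) :
  (f * g)%g x = Some z <-> exists2 y, f x = Some y & g y = Some z.
Proof.
rewrite /mul /= /Defs.pcomp; case: (f x) => [y|] /=; last by split=> [|[]].
by split=> [gz|[_ [<-]]//]; exists y.
Qed.

(** A solution of [s * x = g] extends [IDinf_inv s * g], and a solution of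
[x * s = g] extends [g * IDinf_inv s]. *)
Lemma IDinf_fibers : finite_translation_fibers IDinf.
Proof.
move=> s g; split.
- apply: sub_finite_set (IDinf_finite_extensions (IDinf_inv s * g)%g) => f <-.
  move=> y z /IDinf_mulE [x /partial_inverseP sx] /IDinf_mulE [y'].
  by rewrite sx => -[<-].
- apply: sub_finite_set (IDinf_finite_extensions (g * IDinf_inv s)%g) => f <-.
  move=> x y /IDinf_mulE [z /IDinf_mulE [y' fx sy'] /partial_inverseP sy].
  by rewrite fx (cofinite_isometry_inj (pmap_ofP s) sy' sy).
Qed.

Lemma IDinf_regular (f : IDinf) : (f * IDinf_inv f * f)%g = f.
Proof.
apply: IDinf_ext => x; case fx: (f x) => [y|].
  apply/IDinf_mulE; exists x => //; apply/IDinf_mulE; exists y => //.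
  exact/partial_inverseP.
case E: ((f * IDinf_inv f * f)%g x) => [z|//].
by have /IDinf_mulE [x' /IDinf_mulE [y]] := E; rewrite fx.
Qed.

Theorem mainTheorem5 (R : realType) :
  (forall tau : topology_on IDinf,
     hausdorff_space (tspace tau) -> shift_continuous tau ->
     cech_complete R (tspace tau) -> discrete_space (tspace tau)) /\
  (forall tau : topology_on IDinf,
     hausdorff_space (tspace tau) -> shift_continuous tau ->
     locally_compact [set: tspace tau] -> discrete_space (tspace tau)).
Proof.
have vnr f : exists g : IDinf, (f * g * f)%g = f.
  by exists (IDinf_inv f); exact: IDinf_regular.
split=> tau hT sc.
- move=> [[T1 cr] [F clF remF]].
  exact: regular_semigroup_discrete IDinf_fibers vnr countable_IDinf sc T1
    (completely_regular_regular (R := R) cr) (cech_complete_covers cr clF remF).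
- move=> lc.
  exact: regular_semigroup_discrete IDinf_fibers vnr countable_IDinf sc
    (hausdorff_accessible hT) (locally_compact_regular hT lc)
    (locally_compact_complete_covers lc).
Qed.
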